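(* Let $n=2^{s}$ and $q=2^{r}$ with $s,r$ positive integers. Then for every positive integer $h$, \[ q^{\binom{n}{2}h}MK_{n-1}^{h}=\sum_{i=0}^{h-1}(-1)^{h+i+1}\binom{h}{i}N^{h-i}q^{\binom{n}{2}i}MK_{n-1}^{i} +q\sum_{i=0}^{\min\{N,h\}}(-1)^{h+i}C_{i}\sum_{t=i}^{h}t!\,S(h,t)\,2^{h-t}\binom{N-i}{N-t}, \] where $N=q^{\binom{n}{2}}\prod_{j=2}^{n}(q^{j}-1)$ is the order of $SL(n,q)$, $S(h,t)=\frac{1}{t!}\sum_{j=0}^{t}(-1)^{t-j}\binom{t}{j}j^{h}$ is the Stirling number of the second kind, and $\{C_i\}_{i=0}^{N}$ is the weight distribution of the code $C=C(SL(n,q))$. Moreover, for $0\le i\le N$, \[ C_{i}=\sum\prod_{\beta\in\mathbb{F}_{q}}\binom{n_{\beta}}{\nu_{\beta}}, \] where the sum runs over all families of nonnegative integers $\{\nu_\beta\}_{\beta\in\mathbb{F}_q}$ with $\sum_{\beta}\nu_\beta=i$ and $\sum_{\beta}\nu_\beta\beta=0$ (an identity in $\mathbb{F}_q$), and \[ n_\beta=|\{g\in SL(n,q): Tr(g)=\beta\}|=q^{\binom{n}{2}-1}\Big\{\prod_{j=2}^{n}(q^{j}-1)+1+q\,\theta(\beta)\Big\},\qquad \theta(\beta)=\begin{cases}K_{n-2}(\lambda;\beta^{-1}),&\beta\neq0,\\ 0,&\beta=0.\end{cases} \]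
   Context: $\mathbb{F}_q$ is the finite field with $q$ elements, $tr(x)=x+x^2+\cdots+x^{2^{r-1}}$ is the absolute trace $\mathbb{F}_q\to\mathbb{F}_2$, and $\lambda(x)=(-1)^{tr(x)}$ is the canonical additive character. For a positive integer $m$ and $a\in\mathbb{F}_q^*$, the $m$-dimensional Kloosterman sum is $K_m(\lambda;a)=\sum_{\alpha_1,\dots,\alpha_m\in\mathbb{F}_q^*}\lambda(\alpha_1+\cdots+\alpha_m+a\alpha_1^{-1}\cdots\alpha_m^{-1})$; by convention $K_0(\lambda;a)=\lambda(a)$. The $h$-th moment is $MK_m^{h}=\sum_{a\in\mathbb{F}_q^*}K_m(\lambda;a)^h$ (so $MK_m^0=q-1$). $Tr(g)$ denotes the matrix trace. Fix an ordering $g_1,\dots,g_N$ of $SL(n,q)$ and let $v=(Tr(g_1),\dots,Tr(g_N))\in\mathbb{F}_q^N$; the binary code is $C(SL(n,q))=\{u\in\mathbb{F}_2^N: u\cdot v=0\}$ (dot product computed in $\mathbb{F}_q$). $C_i$ is the number of codewords of Hamming weight $i$ in this code. Convention: $\binom{b}{a}=0$ if $b<a$. *)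

(* Defs.v *)
From HB Require Import structures.
From mathcomp Require Import all_boot all_order all_algebra.
Set Implicit Arguments. Unset Strict Implicit. Unset Printing Implicit Defensive.
Import Order.TTheory GRing.Theory Num.Theory.
Local Open Scope ring_scope.

Section Defs.
Variables (F : finFieldType) (r : nat).

(* absolute trace F_q -> F_2 (values in {0,1} of F), q = 2^r *)
Definition abstr (x : F) : F := \sum_(k < r) x ^+ (2 ^ k)%N.

Definition lam (x : F) : int := if abstr x == 0 then 1 else -1.

(* m-dimensional Kloosterman sum K_m(lambda; a); for m = 0 the sum is over the
   unique empty family and equals lam a, matching the convention. *)
Definition Kloost (m : nat) (a : F) : int :=
  \sum_(al : {ffun 'I_m -> F} | [forall k, al k != 0])
     lam (\sum_(k < m) al k + a * (\prod_(k < m) al k)^-1).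

Definition MK (m h : nat) : int := \sum_(a : F | a != 0) Kloost m a ^+ h.

Definition theta (n : nat) (b : F) : int :=
  if b == 0 then 0 else Kloost (n - 2) b^-1.
End Defs.

Section Code.
Variables (F : finFieldType) (n : nat).

Definition SLset : {set 'M[F]_n} := [set g : 'M[F]_n | \det g == 1].

Definition nbeta (b : F) : nat := #|[set g in SLset | \tr g == b]|.

(* C_i: number of codewords of weight i in C(SL(n,q)); a binary word u is
   identified with its support A (a subset of SL(n,q)); u.v = sum_{g in A} Tr g. *)
Definition Cw (i : nat) : nat :=
  #|[set A : {set 'M[F]_n} |
       [&& A \subset SLset, #|A| == i & \sum_(g in A) \tr g == 0]]|.
End Code.

Definition stirling2 (h t : nat) : rat :=
  (t`!%:R)^-1 * \sum_(j < t.+1) (-1) ^+ (t - j) * 'C(t, j)%:R * (j%:R) ^+ h.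

(* Main.v *)
(** Let [chi] be a nontrivial additive character of a finite field with [q]
    elements.  Left multiplication by a unitriangular matrix preserves the
    determinant; averaging over all of them cancels the contribution of every
    nontriangular matrix to the sum of [chi (\tr g)] over [\det g = d], which is
    therefore [q ^ 'C(n, 2)] times the sum of [chi] over the diagonals of product
    [d], a Kloosterman sum.  Scaling by [a] gives
    [\sum_(g in SL) chi (a * \tr g) = q ^ 'C(n, 2) * K_(n-1)(chi; a ^+ n)], and
    [a ^+ n] may be replaced by [a] when [n] is a power of the characteristic and
    [chi] is invariant under Frobenius.  Orthogonality of characters turns this
    into the distribution of the trace.

    In characteristic two the same sum is [N] minus twice the weight of a dual
    word, and the recursion is the Pless power moment identity: the h-th power of
    a weight is expanded in falling factorials, that is in numbers of t-subsets of
    its support, and orthogonality converts the sum over [a] into a count of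
    codewords.  Expanding [(N - x) ^+ h] binomially isolates the h-th moment. *)

Require Import Defs.
From HB Require Import structures.
From mathcomp Require Import all_boot all_order all_algebra.
From mathcomp Require Import finfield zify ring.
Set Implicit Arguments. Unset Strict Implicit. Unset Printing Implicit Defensive.
Import Order.TTheory GRing.Theory Num.Theory.
Local Open Scope ring_scope.

Lemma exchange_big_triangular (V : nmodType) (N h : nat) (G : nat -> nat -> V) :
  (forall i t, (t < i <= N)%N -> G i t = 0) ->
  \sum_(t < h.+1) \sum_(i < N.+1) G i t =
  \sum_(i < (minn N h).+1) \sum_(i <= t < h.+1) G i t.
Proof.
move=> G0; rewrite exchange_big /= -(big_mkord xpredT (fun i => \sum_(t < h.+1) G i t)).
rewrite (big_cat_nat (n := (minn N h).+1)) ?ltnS ?geq_minl //= [X in _ + X]big_nat.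
rewrite [X in _ + X]big1 ?addr0 => [|i /andP[]]; last first.
  rewrite gtn_min !ltnS => /orP[Ni iN|hi iN]; first by rewrite ltnNge iN in Ni.
  by apply: big1 => t _; apply: G0; rewrite (leq_trans (ltn_ord t) hi).
rewrite big_mkord; apply: eq_bigr => i _.
have /andP[iN ih] : (i <= N)%N && (i <= h)%N by rewrite -leq_min -ltnS.
rewrite -(big_mkord xpredT (G i)) (big_cat_nat (leq0n i) (leqW ih)) /=.
by rewrite big_nat big1 ?add0r // => t /andP[_ ti]; rewrite G0 // ti.
Qed.

Lemma power_sum_recursion (R : comPzRingType) (I : finType) (P : pred I)
    (c : R) (x : I -> R) h :
  \sum_(a | P a) x a ^+ h =
  \sum_(i < h) (-1) ^+ (h + i + 1) * 'C(h, i)%:R * c ^+ (h - i) *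
    (\sum_(a | P a) x a ^+ i)
  + (-1) ^+ h * \sum_(a | P a) (c - x a) ^+ h.
Proof.
have binomial_expansion : \sum_(a | P a) (c - x a) ^+ h =
    \sum_(i < h.+1) (-1) ^+ i * 'C(h, i)%:R * c ^+ (h - i) * \sum_(a | P a) x a ^+ i.
  under eq_bigr do rewrite exprBn.
  rewrite exchange_big; apply: eq_bigr => i _; rewrite mulr_sumr.
  by apply: eq_bigr => a _; rewrite -mulr_natr; ring.
rewrite binomial_expansion big_ord_recr /= binn subnn !mulr1 mulrDr signrMK mulr_sumr addrA.
rewrite -big_split /= [X in _ = X + _]big1 ?add0r // => i _.
by rewrite addn1 exprS exprD; ring.
Qed.

(** * Stirling numbers of the second kind *)

Lemma natr_fact_neq0 t : t`!%:R != 0 :> rat.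
Proof. by rewrite pnatr_eq0 -lt0n fact_gt0. Qed.

Lemma fact_stirling2 h t :
  t`!%:R * stirling2 h t =
  \sum_(j < t.+1) (-1) ^+ (t - j) * 'C(t, j)%:R * j%:R ^+ h.
Proof. by rewrite /stirling2 mulVKf // natr_fact_neq0. Qed.

Lemma stirling20 t : stirling2 0 t = (t == 0%N)%:R.
Proof.
have binomial_sum : t`!%:R * (t == 0%N)%:R = (1 - 1) ^+ t :> rat.
  by rewrite subrr expr0n; case: (t) => [|k]; rewrite ?mulr1 ?mulr0.
apply: (mulfI (natr_fact_neq0 t)); rewrite binomial_sum exprBn fact_stirling2.
rewrite (reindex_inj rev_ord_inj) /=; apply: eq_bigr => j _.
have jt : (j <= t)%N by rewrite -ltnS.
by rewrite subSS subKn // bin_sub // !expr1n !mulr1 mulr_natr.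
Qed.

Lemma stirling2S0 h : stirling2 h.+1 0 = 0.
Proof. by rewrite /stirling2 big_ord1 expr0n !mulr0. Qed.

Lemma stirling2SS h t :
  stirling2 h.+1 t.+1 = t.+1%:R * stirling2 h t.+1 + stirling2 h t.
Proof.
apply: (mulfI (natr_fact_neq0 t.+1)); rewrite mulrDr [X in X + _]mulrCA !fact_stirling2.
rewrite factS natrM -mulrA fact_stirling2.
have -> : \sum_(j < t.+1) (-1) ^+ (t - j) * 'C(t, j)%:R * j%:R ^+ h
    = - \sum_(j < t.+2) (-1) ^+ (t.+1 - j) * 'C(t, j)%:R * j%:R ^+ h :> rat.
  rewrite [in RHS]big_ord_recr /= bin_small // mulr0 mul0r addr0 -sumrN.
  apply: eq_bigr => j _.
  by rewrite subSn -1?ltnS // exprS mulN1r !mulNr opprK.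
rewrite -mulrDr -sumrB mulr_sumr big_ord_recl [RHS]big_ord_recl /=.
rewrite expr0n mulr0 !bin0 subrr mulr0; congr (_ + _).
apply: eq_bigr => j _; rewrite /bump leq0n add1n.
have absorb : j.+1%:R * 'C(t.+1, j.+1)%:R = t.+1%:R * 'C(t, j)%:R :> rat.
  by rewrite -!natrM -mul_bin_diag.
have -> : 'C(t, j.+1)%:R = 'C(t.+1, j.+1)%:R - 'C(t, j)%:R :> rat.
  by rewrite binS natrD addrK.
by rewrite exprS -mulrA [_ * (j.+1%:R * _)]mulrA [_ * j.+1%:R]mulrC absorb; ring.
Qed.

Lemma stirling2_small h t : (h < t)%N -> stirling2 h t = 0.
Proof.
elim: h t => [|h IH] [|t] // ht; first by rewrite stirling20.
by rewrite stirling2SS !IH ?mulr0 ?addr0 // ltnW.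
Qed.

Lemma expr_sum_ffact w h :
  w%:R ^+ h = \sum_(t < h.+1) stirling2 h t * (w ^_ t)%:R :> rat.
Proof.
elim: h => [|h IH]; first by rewrite big_ord1 stirling20 mul1r.
have mulr_ffact t : w%:R * (w ^_ t)%:R = t%:R * (w ^_ t)%:R + (w ^_ t.+1)%:R :> rat.
  rewrite -!natrM -natrD ffactnSr [(t * _)%N]mulnC -mulnDr mulnC.
  by case: (leqP t w) => [/subnKC->|wt] //; rewrite ffact_small.
have shift : \sum_(t < h.+1) stirling2 h t * (t%:R * (w ^_ t)%:R)
    = \sum_(t < h.+1) stirling2 h t.+1 * (t.+1%:R * (w ^_ t.+1)%:R).
  rewrite big_ord_recl [RHS]big_ord_recr /= (stirling2_small (ltnSn h)).
  by rewrite !mul0r mulr0 addr0 add0r.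
rewrite exprS IH mulr_sumr [RHS]big_ord_recl stirling2S0 mul0r add0r /=.
under eq_bigr do rewrite mulrCA mulr_ffact mulrDr.
rewrite big_split /= shift -big_split; apply: eq_bigr => t _ /=.
by rewrite /bump leq0n add1n stirling2SS; ring.
Qed.

(** * Subsets and their fibers *)

(* Without the test, truncated subtraction would give [draws_above N N t = 1] for
   [t > N]. *)
Definition draws_above (N i t : nat) : nat :=
  if (t <= N)%N then 'C(N - i, N - t) else 0.

Section SubsetSums.
Variable X : finType.
Implicit Types A B S W : {set X}.

Lemma card_draws_above A S t : A \subset S ->
  #|[set B : {set X} | [&& A \subset B, B \subset S & #|B| == t]]| =
  draws_above #|S| #|A| t.
Proof.
move=> AS; rewrite /draws_above; case: leqP => tS; last first.
  apply/eqP; rewrite cards_eq0 -subset0; apply/subsetP => B; rewrite inE.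
  by case/and3P => _ /subset_leq_card + /eqP Bt; rewrite Bt leqNgt tS.
have setSDK B : B \subset S -> S :\: (S :\: B) = B.
  by move=> BS; rewrite setDDr setDv set0U (setIidPr BS).
have -> : (#|S| - #|A| = #|S :\: A|)%N by rewrite cardsD (setIidPr AS).
rewrite -cards_draws -[RHS](card_in_imset (f := setD S)) => [|B C]; last first.
  rewrite !inE !subsetD => /andP[/andP[BS _] _] /andP[/andP[CS _] _].
  by move/(congr1 (setD S)); rewrite !setSDK.
apply: eq_card => B; rewrite inE; apply/and3P/imsetP => [[AB BS /eqP Bt]|[C]].
  by exists (S :\: B); rewrite ?setSDK // inE setDS //= cardsD (setIidPr BS) Bt.
rewrite inE subsetD => /andP[/andP[CS CA] /eqP Ct] ->; split.
- by rewrite subsetD AS disjoint_sym.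
- exact: subsetDl.
- by rewrite cardsD (setIidPr CS) Ct subKn.
Qed.

Lemma prodr_1D (R : comPzSemiRingType) (u : X -> R) B :
  \prod_(x in B) (1 + u x) = \sum_(A : {set X} | A \subset B) \prod_(x in A) u x.
Proof.
rewrite big_mkcond /=.
rewrite (eq_bigr (fun x => (if x \in B then u x else 0) + 1)) => [|x _]; last first.
  by case: ifP; rewrite ?add0r // addrC.
rewrite bigA_distr [RHS]big_mkcond /=; apply: eq_bigr => A _.
case: ifP => [/subsetP AB|/negbT/subsetPn[x xA /negPf xB]].
  by rewrite [RHS]big_mkcond; apply: eq_bigr => x _; case: ifP => // /AB ->.
by rewrite (bigD1 x) //= xA xB mul0r.
Qed.

Lemma sum_draws_prod (R : comPzSemiRingType) (c : R) S W t :
  \sum_(B : {set X} | (B \subset S) && (#|B| == t))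
     \prod_(x in B) (if x \in W then c else 0) = c ^+ t *+ 'C(#|S :&: W|, t).
Proof.
rewrite (bigID (fun B : {set X} => B \subset W)) /= addrC big1 ?add0r; last first.
  by move=> B /andP[_ /subsetPn[x xB /negPf xW]]; rewrite (bigD1 x) //= xW mul0r.
rewrite (eq_bigr (fun=> c ^+ t)) => [|B /andP[/andP[_ /eqP <-] /subsetP BW]]; last first.
  by rewrite -prodr_const; apply: eq_bigr => x /BW ->.
rewrite sumr_const -cards_draws; congr (_ *+ _); apply: eq_card => B.
by rewrite !inE unfold_in subsetI andbAC.
Qed.

End SubsetSums.

Section Fibers.
Variables (X J : finType) (f : X -> J).
Implicit Types A B S : {set X}.

Definition fiber A b : {set X} := [set x in A | f x == b].

Lemma sum_fiber (V : nmodType) (G : J -> V) A :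
  \sum_b G b *+ #|fiber A b| = \sum_(x in A) G (f x).
Proof.
rewrite [RHS](partition_big f xpredT) //=; apply: eq_bigr => b _.
rewrite (eq_bigr (fun=> G b)) => [|x /andP[_ /eqP->]] //.
by rewrite sumr_const; congr (_ *+ _); apply: eq_card => x; rewrite inE.
Qed.

Lemma sum_card_fiber A : (\sum_b #|fiber A b|)%N = #|A|.
Proof.
rewrite -sum1_card (partition_big f xpredT) //=.
by apply: eq_bigr => b _; rewrite -sum1_card; apply: eq_bigl => x; rewrite inE.
Qed.

Lemma fiber_inj A B : fiber A =1 fiber B -> A = B.
Proof.
by move=> AB; apply/setP => x; have /setP/(_ x) := AB (f x); rewrite !inE eqxx !andbT.
Qed.

Lemma fiber_bigcup (B : J -> {set X}) :
  (forall b, {in B b, forall x, f x = b}) -> fiber (\bigcup_b B b) =1 B.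
Proof.
move=> fB b; apply/setP => x; rewrite inE.
apply/andP/idP => [[/bigcupP[c _ xc] /eqP <-]|xb]; first by rewrite (fB c).
by split; [apply/bigcupP; exists b | rewrite (fB b)].
Qed.

Lemma card_sets_fiberwise S (nu : J -> nat) :
  #|[set A : {set X} | (A \subset S) && [forall b, #|fiber A b| == nu b]]| =
  (\prod_b 'C(#|fiber S b|, nu b))%N.
Proof.
pose draws b : pred {set X} := fun B => (B \subset fiber S b) && (#|B| == nu b).
pose fibers A : {ffun J -> {set X}} := [ffun b => fiber A b].
have fibers_inj : injective fibers.
  by move=> A B /ffunP AB; apply: fiber_inj => b; have := AB b; rewrite !ffunE.
rewrite -(card_imset _ fibers_inj).
transitivity #|family draws|; last first.
  rewrite card_family foldrE big_map big_enum; apply: eq_bigr => b _.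
  by rewrite -cards_draws cardsE.
apply: eq_card => B; apply/imsetP/familyP => [[A]|drawsB].
  rewrite inE => /andP[/subsetP AS /forallP cardA] -> b.
  rewrite unfold_in /draws ffunE cardA andbT.
  by apply/subsetP => x; rewrite !inE => /andP[/AS -> ->].
have memB b x : x \in B b -> x \in S /\ f x = b.
  have /andP[/subsetP BS _] := drawsB b.
  by move=> /BS; rewrite inE => /andP[-> /eqP].
have fiberB : fiber (\bigcup_b B b) =1 B by apply: fiber_bigcup => b x /memB[].
exists (\bigcup_b B b); last by apply/ffunP => b; rewrite ffunE fiberB.
rewrite inE; apply/andP; split.
  by apply/bigcupsP => b _; apply/subsetP => x /memB[].
by apply/forallP => b; rewrite fiberB; have /andP[] := drawsB b.
Qed.

End Fibers.

Section Codewords.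
Variables (X : finType) (V : nmodType) (S : {set X}) (f : X -> V).

Definition codewords (i : nat) : {set {set X}} :=
  [set A : {set X} | [&& A \subset S, #|A| == i & \sum_(x in A) f x == 0]].

Lemma sum_codewords (W : nmodType) (G : nat -> W) :
  \sum_(A : {set X} | (A \subset S) && (\sum_(x in A) f x == 0)) G #|A| =
  \sum_(i < #|S|.+1) G i *+ #|codewords i|.
Proof.
rewrite (partition_big (fun A : {set X} => inord #|A| : 'I_#|S|.+1) xpredT) //=.
apply: eq_bigr => i _.
have mem_codewords A :
    A \in codewords i = (A \subset S) && (\sum_(x in A) f x == 0) && (inord #|A| == i).
  rewrite inE; case AS: (A \subset S) => //=.
  by rewrite -val_eqE /= inordK ?ltnS ?subset_leq_card // andbC.
rewrite -(eq_bigl _ _ mem_codewords) -sumr_const; apply: eq_bigr => A.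
by rewrite inE => /and3P[_ /eqP->].
Qed.

End Codewords.

Lemma card_codewords_fiberwise (X : finType) (V : finNmodType) (S : {set X})
    (f : X -> V) i :
  #|codewords S f i| =
  (\sum_(nu : {ffun V -> 'I_i.+1} |
           ((\sum_b (nu b : nat))%N == i) && ((\sum_b (b *+ nu b))%R == 0%R))
     \prod_b 'C(#|fiber f S b|, nu b))%N.
Proof.
pose profile A : {ffun V -> 'I_i.+1} := [ffun b => inord #|fiber f A b|].
have profileE (A : {set X}) : #|A| = i -> forall b, profile A b = #|fiber f A b| :> nat.
  move=> Ai b; rewrite ffunE inordK // ltnS -Ai; apply: subset_leq_card.
  by apply/subsetP => x; rewrite inE => /andP[].
rewrite -sum1_card (partition_big profile (fun nu : {ffun V -> 'I_i.+1} =>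
  ((\sum_b (nu b : nat))%N == i) && ((\sum_b (b *+ nu b))%R == 0%R))) /=; last first.
  move=> A; rewrite inE => /and3P[_ /eqP Ai /eqP A0].
  under eq_bigr do rewrite profileE //.
  under [X in _ && (X == _)]eq_bigr do rewrite profileE //.
  by rewrite sum_card_fiber Ai eqxx (sum_fiber f id) A0 eqxx.
apply: eq_bigr => nu /andP[/eqP nui /eqP nu0]; rewrite sum1_card -card_sets_fiberwise.
apply: eq_card => A; rewrite unfold_in !inE -!andbA; congr (_ && _).
apply/and3P/forallP => [[/eqP Ai _ /eqP <-] b|cardA]; first by rewrite profileE.
have Ai : #|A| = i.
  by rewrite -(sum_card_fiber f) -[RHS]nui; apply: eq_bigr => b _; apply/eqP.
split; first exact/eqP.
  apply/eqP; rewrite -(sum_fiber f id) -[RHS]nu0.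
  by apply: eq_bigr => b _; rewrite (eqP (cardA b)).
by apply/eqP/ffunP => b; apply/val_inj; rewrite /= profileE //; apply/eqP.
Qed.

(** * Additive characters and Kloosterman sums *)

Record nontrivial_add_char (V : zmodType) (R : pzRingType) (chi : V -> R) : Prop :=
  NontrivialAddChar {
    add_char0 : chi 0 = 1;
    add_charD : {morph chi : x y / x + y >-> x * y};
    add_char_neq1 : exists x, chi x != 1
  }.

Lemma nontrivial_add_char_comp (V : zmodType) (R R' : pzRingType)
    (phi : {rmorphism R -> R'}) (chi : V -> R) :
  injective phi -> nontrivial_add_char chi -> nontrivial_add_char (phi \o chi).
Proof.
move=> phi_inj [chi0 chiD [x chix]].
split=> [|y z|]; rewrite /= ?chi0 ?chiD ?rmorph1 ?rmorphM //.
by exists x; rewrite /= -(rmorph1 phi) (inj_eq phi_inj).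
Qed.

Lemma sum_translate_eigen (V : finZmodType) (R : idomainType) (P : pred V)
    (f : V -> R) (v0 : V) (c : R) :
  c != 1 -> (forall v, P (v + v0) = P v) -> (forall v, f (v + v0) = f v * c) ->
  \sum_(v | P v) f v = 0.
Proof.
move=> c1 Pv0 fv0; set s := \sum_(_ | _) _.
have s_eigen : s = s * c.
  rewrite {1}/s (reindex_inj (addIr v0)) mulr_suml /=.
  by apply: eq_big => v // _; rewrite fv0.
have /eqP : s * (c - 1) = 0 by rewrite mulrBr mulr1 -s_eigen subrr.
by rewrite mulf_eq0 subr_eq0 (negPf c1) orbF => /eqP.
Qed.

Section AdditiveCharacters.
Variables (F : finFieldType) (R : idomainType) (chi : F -> R).
Hypothesis chiP : nontrivial_add_char chi.

Lemma add_char_sum (I : finType) (P : pred I) (f : I -> F) :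
  chi (\sum_(i | P i) f i) = \prod_(i | P i) chi (f i).
Proof. exact: (big_morph _ (add_charD chiP) (add_char0 chiP)). Qed.

Lemma add_char_orthogonal a : \sum_x chi (a * x) = if a == 0 then #|F|%:R else 0.
Proof.
case: eqP => [->|/eqP a0].
  under eq_bigr do rewrite mul0r (add_char0 chiP).
  by rewrite sumr_const.
have [y chiy] := add_char_neq1 chiP.
apply: (@sum_translate_eigen F R xpredT _ (a^-1 * y) _ chiy) => // x.
by rewrite mulrDr mulVKf // (add_charD chiP).
Qed.

Lemma add_char_orthogonal_neq0 a :
  \sum_(x | x != 0) chi (a * x) = (if a == 0 then #|F|%:R else 0) - 1.
Proof.
rewrite -add_char_orthogonal [in RHS](bigD1 0) //= mulr0 (add_char0 chiP).
by rewrite addrAC subrr add0r.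
Qed.

Lemma add_char_pm1 : 2 \in [pchar F] -> forall x, (chi x == 1) || (chi x == -1).
Proof.
move=> char2 x; rewrite -sqrf_eq1 expr2 -(add_charD chiP) (addrr_pchar2 char2).
by rewrite (add_char0 chiP).
Qed.

End AdditiveCharacters.

Section FfunCons.
Variables (T : finType) (m : nat).
Implicit Types (x : T) (al : {ffun 'I_m -> T}).

Definition ffun_cons x al : {ffun 'I_m.+1 -> T} :=
  [ffun i => if unlift ord0 i is Some j then al j else x].

Lemma ffun_cons0 x al : ffun_cons x al ord0 = x.
Proof. by rewrite ffunE unlift_none. Qed.

Lemma ffun_consS x al j : ffun_cons x al (lift ord0 j) = al j.
Proof. by rewrite ffunE liftK. Qed.

Lemma big_ord_ffun_cons (V : Type) (idx : V) (op : Monoid.law idx) (G : T -> V) x al :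
  \big[op/idx]_i G (ffun_cons x al i) = op (G x) (\big[op/idx]_i G (al i)).
Proof.
rewrite big_ord_recl ffun_cons0; congr (op _ _).
by apply: eq_bigr => j _; rewrite ffun_consS.
Qed.

Lemma big_ffun_ordS (V : Type) (idx : V) (op : Monoid.com_law idx)
    (P : pred {ffun 'I_m.+1 -> T}) (G : {ffun 'I_m.+1 -> T} -> V) :
  \big[op/idx]_(be | P be) G be =
  \big[op/idx]_al \big[op/idx]_(x | P (ffun_cons x al)) G (ffun_cons x al).
Proof.
rewrite pair_big_dep /=.
rewrite (reindex (fun p : {ffun 'I_m -> T} * T => ffun_cons p.2 p.1)) //=.
exists (fun be => ([ffun j => be (lift ord0 j)], be ord0)) => [[al x] _|be _] /=.
  by rewrite ffun_cons0; congr (_, _); apply/ffunP => j; rewrite ffunE ffun_consS.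
apply/ffunP => i; case: (unliftP ord0 i) => [j|] ->; last by rewrite ffun_cons0.
by rewrite ffun_consS ffunE.
Qed.

End FfunCons.

Lemma prodf_neq0_forall (F : fieldType) (I : finType) (f : I -> F) :
  (\prod_i f i != 0) = [forall i, f i != 0].
Proof. by apply/prodf_neq0/forallP => f0 i //; apply: f0. Qed.

Section KloostermanSums.
Variables (F : finFieldType) (V : nmodType) (chi : F -> V).

Definition kloosterman m a : V :=
  \sum_(al : {ffun 'I_m -> F} | [forall k, al k != 0])
     chi (\sum_k al k + a * (\prod_k al k)^-1).

Definition hyper_kloosterman m d : V :=
  \sum_(al : {ffun 'I_m -> F} | \prod_k al k == d) chi (\sum_k al k).

Definition kloosterman_inv m b : V := if b == 0 then 0 else kloosterman m b^-1.

Lemma hyper_kloostermanS m d :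
  d != 0 -> hyper_kloosterman m.+1 d = kloosterman m d.
Proof.
move=> d0; rewrite /hyper_kloosterman big_ffun_ordS /kloosterman [RHS]big_mkcond.
apply: eq_bigr => al _; rewrite -prodf_neq0_forall.
transitivity (\sum_(x | x * \prod_k al k == d) chi (x + \sum_k al k)).
  by apply: eq_big => [x|x _]; rewrite (big_ord_ffun_cons _ id).
case: eqVneq => [->|al0].
  by rewrite big1 // => x; rewrite mulr0 eq_sym (negPf d0).
rewrite (big_pred1 (d * (\prod_k al k)^-1)) => [|x]; first by rewrite addrC.
by rewrite (can2_eq (mulfK al0) (divfK al0)).
Qed.

Lemma hyper_kloosterman_inv m b :
  \sum_(al : {ffun 'I_m.+1 -> F} | [forall k, al k != 0] && ((\prod_k al k)^-1 == b))
     chi (\sum_k al k) = kloosterman_inv m b.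
Proof.
rewrite /kloosterman_inv; case: eqVneq => [->|b0].
  by rewrite big1 // => al; rewrite invr_eq0 -prodf_neq0_forall andNb.
rewrite -hyper_kloostermanS ?invr_eq0 //; apply: eq_bigl => al.
rewrite -prodf_neq0_forall (can2_eq (@invrK _) (@invrK _)).
by apply/andP/idP => [[]|/eqP e] //; rewrite e invr_eq0.
Qed.

Lemma kloosterman_auto (phi : {rmorphism F -> F}) m a :
  (forall x, chi (phi x) = chi x) -> kloosterman m (phi a) = kloosterman m a.
Proof.
move=> chi_phi; pose map_phi (al : {ffun 'I_m -> F}) := [ffun k => phi (al k)].
have map_inj : injective map_phi.
  move=> al be /ffunP eq_phi; apply/ffunP => k; apply: (fmorph_inj phi).
  by have := eq_phi k; rewrite !ffunE.
rewrite /kloosterman (reindex_inj map_inj); apply: eq_big => [al|al _].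
  by apply: eq_forallb => k; rewrite ffunE fmorph_eq0.
rewrite -[RHS]chi_phi rmorphD rmorphM fmorphV rmorph_sum rmorph_prod.
by congr (chi (_ + _ * _^-1)); apply: eq_bigr => k _; rewrite ffunE.
Qed.

Lemma kloosterman_pchar p s m a : p \in [pchar F] ->
  (forall x, chi (x ^+ p) = chi x) -> kloosterman m (a ^+ (p ^ s)) = kloosterman m a.
Proof.
move=> charFp chi_p; elim: s => [|s IH]; first by rewrite expr1.
by rewrite expnSr exprM (kloosterman_auto (phi := pFrobenius_aut charFp)).
Qed.

End KloostermanSums.

Lemma kloosterman_comp (F : finFieldType) (V W : nmodType) (phi : {additive V -> W})
    (chi : F -> V) m a :
  kloosterman (phi \o chi) m a = phi (kloosterman chi m a).
Proof. by rewrite /kloosterman raddf_sum. Qed.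

Section KloostermanTwist.
Variables (F : finFieldType) (R : idomainType) (chi : F -> R).
Hypothesis chiP : nontrivial_add_char chi.

Lemma sum_add_char_units m :
  \sum_(al : {ffun 'I_m -> F} | [forall k, al k != 0]) chi (\sum_k al k) = (-1) ^+ m.
Proof.
have := add_char_orthogonal_neq0 chiP 1; rewrite oner_eq0 sub0r => <-.
under eq_bigr do rewrite (add_char_sum chiP).
rewrite -[m in RHS]card_ord -prodr_const bigA_distr_big.
apply: eq_big => [al|al _]; first by apply/forallP/ffun_onP.
by apply: eq_bigr => k _; rewrite mul1r.
Qed.

Lemma sum_kloosterman_twist m b :
  \sum_(a | a != 0) chi (- (a * b)) * kloosterman chi m.+1 a =
  #|F|%:R * kloosterman_inv chi m b - (-1) ^+ m.+1.
Proof.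
have sum_twist (al : {ffun 'I_m.+1 -> F}) :
    \sum_(a | a != 0) chi (- (a * b)) * chi (\sum_k al k + a * (\prod_k al k)^-1) =
    chi (\sum_k al k) * ((if (\prod_k al k)^-1 == b then #|F|%:R else 0) - 1).
  rewrite -subr_eq0 -(add_char_orthogonal_neq0 chiP) mulr_sumr.
  by apply: eq_bigr => a _; rewrite -!(add_charD chiP); congr chi; ring.
rewrite /kloosterman; under eq_bigr do rewrite mulr_sumr.
rewrite exchange_big /= (eq_bigr _ (fun al _ => sum_twist al)).
under eq_bigr do rewrite mulrBr mulr1.
rewrite sumrB sum_add_char_units -hyper_kloosterman_inv mulr_sumr big_mkcondr.
by congr (_ - _); apply: eq_bigr => al _; case: ifP; rewrite ?mulr0 // mulrC.
Qed.

End KloostermanTwist.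

(** * Character sums over matrices of given determinant *)

Section StrictlyTriangular.
Variable V : nmodType.

Definition is_strict_trig_mx n (A : 'M[V]_n) :=
  [forall i : 'I_n, forall j : 'I_n, (i <= j)%N ==> (A i j == 0)].

Lemma is_strict_trig_mxP n (A : 'M[V]_n) :
  reflect (forall i j : 'I_n, (i <= j)%N -> A i j = 0) (is_strict_trig_mx A).
Proof.
apply: (iffP 'forall_'forall_implyP) => A0 i j ij; first exact/eqP/A0.
by rewrite A0.
Qed.

End StrictlyTriangular.

Lemma is_strict_trig_mxDr (V : zmodType) n (A B : 'M[V]_n) :
  is_strict_trig_mx B -> is_strict_trig_mx (A + B) = is_strict_trig_mx A.
Proof.
move=> /is_strict_trig_mxP B0; apply/is_strict_trig_mxP/is_strict_trig_mxP => A0 i j ij;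
  by have := A0 i j ij; rewrite mxE (B0 _ _ ij) addr0.
Qed.

Lemma is_strict_trig_mxB_diag (V : zmodType) n (A : 'M[V]_n) (d : 'rV[V]_n) :
  is_strict_trig_mx (A - diag_mx d) = is_trig_mx A && [forall i, A i i == d 0 i].
Proof.
apply/is_strict_trig_mxP/andP => [A0|[/is_trig_mxP trigA /forallP diagA] i j].
  split; [apply/is_trig_mxP => i j ij|apply/forallP => i].
    by have := A0 i j (ltnW ij); rewrite !mxE -val_eqE /= ltn_eqF // mulr0n subr0.
  by have := A0 i i (leqnn i); rewrite !mxE eqxx mulr1n => /eqP; rewrite subr_eq0.
rewrite leq_eqVlt => /orP[/eqP/val_inj <-|ij].
  by rewrite !mxE eqxx mulr1n (eqP (diagA i)) subrr.
by rewrite !mxE -val_eqE /= ltn_eqF // mulr0n subr0 trigA.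
Qed.

Lemma card_ltn_pairs n : #|[pred p : 'I_n * 'I_n | (p.2 < p.1)%N]| = 'C(n, 2).
Proof.
rewrite -sum1_card.
rewrite -(pair_big_dep xpredT (fun i j : 'I_n => (j < i)%N) (fun _ _ => 1%N)) /=.
rewrite -bin2_sum big_mkord; apply: eq_bigr => i _.
by rewrite (big_ord_narrow (ltnW (ltn_ord i))) sum1_card card_ord.
Qed.

Lemma card_strict_trig_mx (V : finZmodType) n :
  #|[set A : 'M[V]_n | is_strict_trig_mx A]| = (#|V| ^ 'C(n, 2))%N.
Proof.
pose below := [pred p : 'I_n * 'I_n | (p.2 < p.1)%N].
pose matrix_of (f : {ffun 'I_n * 'I_n -> V}) : 'M[V]_n := \matrix_(i, j) f (i, j).
have matrix_of_inj : injective matrix_of.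
  by move=> f g /matrixP fg; apply/ffunP => -[i j]; have := fg i j; rewrite !mxE.
rewrite -card_ltn_pairs -(card_pffun_on 0 below V) -(card_imset _ matrix_of_inj).
apply: eq_card => A; rewrite inE; apply/is_strict_trig_mxP/imsetP => [A0|[f]].
  exists [ffun p => A p.1 p.2]; last by apply/matrixP => i j; rewrite !mxE ffunE.
  apply/pffun_onP; split=> [|x _] //; apply/supportP => -[i j].
  by rewrite ffunE inE /= -leqNgt => /A0.
move=> /pffun_onP[/supportP f0 _] -> i j ij; rewrite mxE f0 //.
by rewrite inE /= -leqNgt.
Qed.

Lemma card_trig_mx_diag (V : finZmodType) n (d : 'rV[V]_n) :
  #|[set A : 'M[V]_n | is_trig_mx A && [forall i, A i i == d 0 i]]| =
  (#|V| ^ 'C(n, 2))%N.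
Proof.
rewrite -card_strict_trig_mx -[RHS](card_preimset _ (addIr (- diag_mx d))).
by apply: eq_card => A; rewrite !inE is_strict_trig_mxB_diag.
Qed.

Lemma det_unitriangular (R : comPzRingType) n (A : 'M[R]_n) :
  is_strict_trig_mx A -> \det (1%:M + A) = 1.
Proof.
move=> /is_strict_trig_mxP A0; rewrite det_trig.
  by rewrite big1 // => i _; rewrite !mxE eqxx A0 // addr0.
apply/is_trig_mxP => i j ij.
by rewrite !mxE A0 ?(ltnW ij) // -val_eqE /= ltn_eqF // addr0.
Qed.

Lemma mxtrace_mul_delta (R : pzSemiRingType) n (A : 'M[R]_n) i j :
  \tr (delta_mx j i *m A) = A i j.
Proof.
rewrite /mxtrace (bigD1 j) //= big1 ?addr0 => [|k /negPf kj].
  rewrite mxE (bigD1 i) //= big1 ?addr0 => [|k /negPf ki].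
    by rewrite mxE !eqxx mul1r.
  by rewrite mxE ki andbF mul0r.
by rewrite mxE big1 // => l _; rewrite mxE kj mul0r.
Qed.

Lemma mxtrace_mul_strict_trig (R : pzSemiRingType) n (A B : 'M[R]_n) :
  is_strict_trig_mx A -> is_trig_mx B -> \tr (A *m B) = 0.
Proof.
move=> /is_strict_trig_mxP A0 /is_trig_mxP B0; rewrite /mxtrace big1 // => i _.
rewrite mxE big1 // => j _.
by have [ij|ji] := leqP i j; rewrite ?(A0 i j ij) ?(B0 j i ji) ?mul0r ?mulr0.
Qed.

Section DeterminantFibers.
Variables (F : finFieldType) (n : nat).
Implicit Types (d : F) (u : 'M[F]_n).

Lemma sum_det_mulmx (V : nmodType) (G : 'M[F]_n -> V) u d :
  u \in unitmx ->
  \sum_(g | \det g == d) G (u *m g) = \sum_(g | \det g == \det u * d) G g.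
Proof.
move=> unit_u; rewrite [RHS](reindex_inj (can_inj (mulKmx unit_u))) /=.
apply: eq_bigl => g; rewrite det_mulmx (inj_eq (mulfI _)) //.
by rewrite -unitfE -unitmxE.
Qed.

Lemma card_det_fiber d : (0 < n)%N -> d != 0 ->
  #|[set g : 'M[F]_n | \det g == d]| = #|SLset F n|.
Proof.
move=> n_gt0 d0; pose i0 := Ordinal n_gt0.
pose D : 'M[F]_n := diag_mx (\row_i (if i == i0 then d else 1)).
have detD : \det D = d.
  rewrite det_diag (bigD1 i0) //= mxE eqxx big1 ?mulr1 // => i /negPf ii0.
  by rewrite mxE ii0.
have unitD : D \in unitmx by rewrite unitmxE detD unitfE.
rewrite -[LHS]sum1dep_card -[RHS]sum1dep_card.
by rewrite -[d]mulr1 -{1}detD -(sum_det_mulmx (fun=> 1%N) _ unitD).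
Qed.

End DeterminantFibers.

Lemma card_GL_det (F : finFieldType) n : (0 < n)%N ->
  #|'GL_n[F]%g| = (\sum_(d | d != 0%R) #|[set g : 'M[F]_n | \det g == d]|)%N.
Proof.
case: n => // n _; rewrite cardsT card_sub -sum1_card.
rewrite (partition_big (fun g : 'M[F]_n.+1 => \det g) (fun d => d != 0)) /=; last first.
  by move=> g; rewrite -unitfE.
apply: eq_bigr => d d0; rewrite sum1_card; apply: eq_card => g; rewrite inE unfold_in.
rewrite -[g \in _]/(g \in unitmx) unitmxE.
by case: eqP => [->|_]; rewrite ?andbF // unitfE d0.
Qed.

Lemma card_SLset (F : finFieldType) n : (0 < n)%N ->
  #|SLset F n| = (#|F| ^ 'C(n, 2) * \prod_(2 <= j < n.+1) (#|F| ^ j - 1))%N.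
Proof.
move=> n_gt0; have q1 : (0 < #|F| - 1)%N by rewrite subn_gt0 finNzRing_gt1.
apply/eqP; rewrite -(eqn_pmul2l q1) mulnCA; apply/eqP.
have -> : ((#|F| - 1) * \prod_(2 <= j < n.+1) (#|F| ^ j - 1) =
          \prod_(1 <= j < n.+1) (#|F| ^ j - 1))%N by rewrite [RHS]big_ltn.
rewrite -card_GL // card_GL_det //.
rewrite (eq_bigr _ (fun d => card_det_fiber n_gt0)) sum_nat_const.
by rewrite (cardC1 (0 : F)) subn1.
Qed.

Section TraceCharacterSums.
Variables (F : finFieldType) (R : numDomainType) (chi : F -> R) (n : nat).
Hypothesis chiP : nontrivial_add_char chi.
Local Notation q := #|F|.

Lemma sum_strict_trig_char (g : 'M[F]_n) :
  \sum_(m : 'M[F]_n | is_strict_trig_mx m) chi (\tr (m *m g)) =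
  if is_trig_mx g then (q ^ 'C(n, 2))%:R else 0.
Proof.
case: ifP => [trig_g|/negbT].
  rewrite (eq_bigr (fun=> 1)) => [|m strict_m].
    by rewrite sumr_const -cardsE card_strict_trig_mx.
  by rewrite mxtrace_mul_strict_trig // (add_char0 chiP).
rewrite negb_forall => /existsP[i]; rewrite negb_forall => /existsP[j].
rewrite negb_imply => /andP[ij gij].
have [y chiy] := add_char_neq1 chiP.
pose m0 : 'M[F]_n := (y / g i j) *: delta_mx j i.
have strict_m0 : is_strict_trig_mx m0.
  apply/is_strict_trig_mxP => k l kl; rewrite !mxE.
  case: andP => [[/eqP kj /eqP li]|_]; last by rewrite mulr0.
  by move: kl; rewrite kj li leqNgt ij.
apply: (sum_translate_eigen (v0 := m0) chiy) => m; first exact: is_strict_trig_mxDr.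
rewrite mulmxDl raddfD /= (add_charD chiP) -scalemxAl mxtraceZ mxtrace_mul_delta.
by rewrite divfK.
Qed.

Lemma sum_det_trig (d : F) :
  \sum_(g : 'M[F]_n | (\det g == d) && is_trig_mx g) chi (\tr g) =
  (q ^ 'C(n, 2))%:R * hyper_kloosterman chi n d.
Proof.
rewrite (partition_big (fun g : 'M[F]_n => [ffun i => g i i])
   (fun al : {ffun 'I_n -> F} => \prod_k al k == d)) /=; last first.
  move=> g /andP[/eqP <- trig_g]; rewrite det_trig //; apply/eqP; apply: eq_bigr => i _.
  by rewrite ffunE.
rewrite mulr_sumr; apply: eq_bigr => al /eqP prod_al.
rewrite (eq_bigr (fun=> chi (\sum_k al k))) => [|g /andP[_ /eqP <-]]; last first.
  by congr chi; apply: eq_bigr => i _; rewrite ffunE.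
rewrite sumr_const -[LHS]mulr_natl -(card_trig_mx_diag (\row_i al i)) -[in LHS]cardsE.
congr (_%:R * _); apply: eq_card => g; rewrite !inE unfold_in.
have -> : [forall i, g i i == (\row_i al i) 0 i] = ([ffun i => g i i] == al).
  apply/forallP/eqP => [diag_g|<- i]; last by rewrite mxE ffunE.
  by apply/ffunP => i; rewrite ffunE (eqP (diag_g i)) mxE.
rewrite -andbA; case: (_ =P al) => [diag_g|_]; last by rewrite !andbF.
rewrite !andbT; case trig_g: (is_trig_mx g); rewrite ?andbF // andbT det_trig // -prod_al.
by apply/eqP; apply: eq_bigr => i _; rewrite -diag_g ffunE.
Qed.

Lemma sum_det_char (d : F) :
  \sum_(g : 'M[F]_n | \det g == d) chi (\tr g) =
  (q ^ 'C(n, 2))%:R * hyper_kloosterman chi n d.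
Proof.
have natq_neq0 : (q ^ 'C(n, 2))%:R != 0 :> R.
  by rewrite pnatr_eq0 -lt0n expn_gt0 (ltnW (finNzRing_gt1 F)).
rewrite -sum_det_trig; apply: (mulfI natq_neq0).
transitivity (\sum_(m : 'M[F]_n | is_strict_trig_mx m)
    \sum_(g : 'M[F]_n | \det g == d) chi (\tr ((1%:M + m) *m g))).
  rewrite -card_strict_trig_mx -sum1_card natr_sum mulr_suml.
  apply: eq_big => [m|m]; rewrite inE // => strict_m; rewrite mul1r.
  rewrite (sum_det_mulmx (fun g => chi (\tr g))) ?det_unitriangular ?mul1r //.
  by rewrite unitmxE det_unitriangular // unitr1.
rewrite exchange_big /= big_mkcondr /= mulr_sumr; apply: eq_bigr => g _.
under eq_bigr do rewrite mulmxDl mul1mx raddfD /= (add_charD chiP).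
rewrite -mulr_sumr sum_strict_trig_char mulrC.
by case: ifP; rewrite ?mulr0 ?mul0r.
Qed.

Lemma sum_SL_char (a : F) : (0 < n)%N -> a != 0 ->
  \sum_(g in SLset F n) chi (a * \tr g) =
  (q ^ 'C(n, 2))%:R * kloosterman chi n.-1 (a ^+ n).
Proof.
move=> n_gt0 a0; rewrite -hyper_kloostermanS ?expf_neq0 // prednK // -sum_det_char.
rewrite [RHS](reindex_inj (can_inj (scalerK a0))) /=.
apply: eq_big => [g|g _]; last by rewrite mxtraceZ.
by rewrite inE detZ -[X in _ = (_ == X)]mulr1 (inj_eq (mulfI (expf_neq0 _ a0))).
Qed.

Lemma card_SL_trace (b : F) : (0 < n)%N ->
  q%:R * (nbeta n b)%:R = #|SLset F n|%:R +
    (q ^ 'C(n, 2))%:R *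
      (\sum_(a | a != 0) chi (- (a * b)) * kloosterman chi n.-1 (a ^+ n)).
Proof.
move=> n_gt0.
transitivity (\sum_(g in SLset F n) \sum_a chi ((\tr g - b) * a)).
  under eq_bigr do rewrite (add_char_orthogonal chiP).
  rewrite -big_mkcondr sumr_const -[RHS]mulr_natr; congr (_ * _%:R).
  by apply: eq_card => g; rewrite inE [RHS]unfold_in subr_eq0.
rewrite exchange_big /= (bigD1 0) //=; congr (_ + _).
  by rewrite (eq_bigr (fun=> 1)) ?sumr_const // => g _; rewrite mulr0 (add_char0 chiP).
rewrite mulr_sumr; apply: eq_bigr => a a0; rewrite mulrCA -sum_SL_char // mulr_sumr.
by apply: eq_bigr => g _; rewrite -(add_charD chiP); congr chi; ring.
Qed.

End TraceCharacterSums.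

Section FrobeniusInvariant.
Variables (F : finFieldType) (R : numDomainType) (chi : F -> R) (p s : nat).
Hypothesis chiP : nontrivial_add_char chi.
Hypotheses (charFp : p \in [pchar F]) (chi_p : forall x, chi (x ^+ p) = chi x).
Local Notation n := (p ^ s)%N.
Local Notation q := #|F|.

Lemma sum_SL_char_pchar (a : F) : a != 0 ->
  \sum_(g in SLset F n) chi (a * \tr g) =
  (q ^ 'C(n, 2))%:R * kloosterman chi n.-1 a.
Proof.
have p_gt0 := prime_gt0 (pcharf_prime charFp).
by move=> a0; rewrite sum_SL_char ?expn_gt0 ?p_gt0 // kloosterman_pchar.
Qed.

Lemma card_SL_trace_pchar (b : F) : (0 < s)%N ->
  q%:R * (nbeta n b)%:R = #|SLset F n|%:R +
    (q ^ 'C(n, 2))%:R * (q%:R * kloosterman_inv chi (n - 2) b - (-1) ^+ n.-1) :> R.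
Proof.
move=> s_gt0; have p_gt1 := prime_gt1 (pcharf_prime charFp).
have n_gt1 : (1 < n)%N by rewrite -(exp1n s) ltn_exp2r.
have n2 : n.-1 = (n - 2).+1 by lia.
rewrite (card_SL_trace chiP) ?(ltnW n_gt1) // n2 -(sum_kloosterman_twist chiP).
congr (_ + _ * _); apply: eq_bigr => a _; congr (_ * _).
exact: kloosterman_pchar.
Qed.

End FrobeniusInvariant.

(** * Power moments of binary codes *)

Section CharacterSumsOverSubsets.
Variables (F : finFieldType) (R : idomainType) (chi : F -> R).
Hypothesis chiP : nontrivial_add_char chi.
Variables (X : finType) (f : X -> F).

Lemma sum_prod_1B_char (B : {set X}) :
  \sum_a \prod_(x in B) (1 - chi (a * f x)) =
  #|F|%:R * \sum_(A : {set X} | (A \subset B) && (\sum_(x in A) f x == 0)) (-1) ^+ #|A|.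
Proof.
under eq_bigr do rewrite prodr_1D.
rewrite exchange_big /= big_mkcondr /= mulr_sumr; apply: eq_bigr => A _.
transitivity (\sum_a (-1) ^+ #|A| * chi ((\sum_(x in A) f x) * a)).
  apply: eq_bigr => a _; rewrite prodrN -(add_char_sum chiP); congr (_ * chi _).
  by rewrite mulr_suml; apply: eq_bigr => x _; rewrite mulrC.
rewrite -mulr_sumr (add_char_orthogonal chiP) mulrC.
by case: ifP; rewrite ?mulr0 ?mul0r.
Qed.

Lemma sum_draws_prod_1B_char (S : {set X}) t :
  \sum_a \sum_(B : {set X} | (B \subset S) && (#|B| == t))
     \prod_(x in B) (1 - chi (a * f x)) =
  #|F|%:R * \sum_(i < #|S|.+1) (-1) ^+ i * #|codewords S f i|%:R *
     (draws_above #|S| i t)%:R.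
Proof.
rewrite exchange_big /=; under eq_bigr do rewrite sum_prod_1B_char.
rewrite -mulr_sumr; congr (_ * _).
rewrite (exchange_big_dep
  (fun A : {set X} => (A \subset S) && (\sum_(x in A) f x == 0))) /=; last first.
  by move=> B A /andP[BS _] /andP[AB ->]; rewrite (subset_trans AB BS).
pose G i : R := (-1) ^+ i * (draws_above #|S| i t)%:R.
transitivity (\sum_(A : {set X} | (A \subset S) && (\sum_(x in A) f x == 0)) G #|A|).
  apply: eq_bigr => A /andP[AS A0].
  rewrite sumr_const -[LHS]mulr_natr /G -card_draws_above //.
  by congr (_ * _%:R); apply: eq_card => B; rewrite inE unfold_in A0 andbT andbC.
rewrite sum_codewords; apply: eq_bigr => i _.
by rewrite -[LHS]mulr_natr mulrAC.
Qed.

End CharacterSumsOverSubsets.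

Section DualWeights.
Variables (F : finFieldType) (R : idomainType) (chi : F -> R).
Hypotheses (chiP : nontrivial_add_char chi) (char2 : 2 \in [pchar F]).
Variables (X : finType) (S : {set X}) (f : X -> F).

(* The field element [a] indexes the dual word whose support is counted here.
   Distinct indices may give the same word, so the sums over [a] count dual words
   with multiplicity. *)
Definition dual_weight a : nat := #|[set x in S | chi (a * f x) != 1]|.

Lemma subr_1_char y : 1 - chi y = if chi y != 1 then 2 else 0.
Proof.
case: eqVneq => [->|chiy]; first by rewrite subrr.
have /orP[/eqP e|/eqP->] := add_char_pm1 chiP char2 y; last by rewrite opprK.
by rewrite e eqxx in chiy.
Qed.

Lemma two_dual_weight a :
  2 * (dual_weight a)%:R = #|S|%:R - \sum_(x in S) chi (a * f x).
Proof.
transitivity (\sum_(x in S) (1 - chi (a * f x))); last by rewrite sumrB sumr_const.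
under eq_bigr do rewrite subr_1_char.
rewrite -big_mkcondr sumr_const mulr_natr; congr (_ *+ _).
by apply: eq_card => x; rewrite inE unfold_in.
Qed.

Lemma bin_dual_weight a t :
  2 ^+ t * 'C(dual_weight a, t)%:R =
  \sum_(B : {set X} | (B \subset S) && (#|B| == t)) \prod_(x in B) (1 - chi (a * f x)).
Proof.
rewrite mulr_natr /dual_weight setIdE -sum_draws_prod.
by apply: eq_bigr => B _; apply: eq_bigr => x _; rewrite subr_1_char inE.
Qed.

End DualWeights.

Definition pless_coef (N h i : nat) : rat :=
  \sum_(i <= t < h.+1) t`!%:R * stirling2 h t * 2 ^+ (h - t) * (draws_above N i t)%:R.

Section BinaryPowerMoments.
Variables (F : finFieldType) (chi : F -> rat).
Hypotheses (chiP : nontrivial_add_char chi) (char2 : 2 \in [pchar F]).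
Variables (X : finType) (S : {set X}) (f : X -> F).
Local Notation q := #|F|.
Local Notation N := #|S|.

Lemma pless_power_moment h :
  \sum_a (2 * (dual_weight chi S f a)%:R) ^+ h =
  q%:R * \sum_(i < (minn N h).+1) (-1) ^+ i * #|codewords S f i|%:R * pless_coef N h i.
Proof.
pose G i t := (-1) ^+ i * #|codewords S f i|%:R *
  (t`!%:R * stirling2 h t * 2 ^+ (h - t) * (draws_above N i t)%:R).
have G0 i t : (t < i <= N)%N -> G i t = 0.
  move=> /andP[ti iN]; rewrite /G /draws_above bin_small; last by lia.
  by rewrite if_same !mulr0.
under [X in _ = _ * X]eq_bigr do rewrite /pless_coef mulr_sumr.
rewrite -(exchange_big_triangular h G0) mulr_sumr.
under eq_bigr do rewrite exprMn (expr_sum_ffact (dual_weight _ _ _ _)) mulr_sumr.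
rewrite exchange_big /=; apply: eq_bigr => t _.
have th : (t <= h)%N by rewrite -ltnS.
transitivity (t`!%:R * stirling2 h t * 2 ^+ (h - t) *
    \sum_a 2 ^+ t * 'C(dual_weight chi S f a, t)%:R).
  rewrite mulr_sumr; apply: eq_bigr => a _.
  by rewrite -bin_ffact natrM -{1}(subnK th) exprD; ring.
rewrite (eq_bigr _ (fun a _ => bin_dual_weight chiP char2 S f a t)).
rewrite sum_draws_prod_1B_char // mulrCA mulr_sumr; congr (_ * _).
by apply: eq_bigr => i _; rewrite /G mulrCA mulrA.
Qed.

Lemma char_sum_moment_recursion h : (0 < h)%N ->
  \sum_(a | a != 0) (\sum_(x in S) chi (a * f x)) ^+ h =
  \sum_(i < h) (-1) ^+ (h + i + 1) * 'C(h, i)%:R * N%:R ^+ (h - i) *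
     (\sum_(a | a != 0) (\sum_(x in S) chi (a * f x)) ^+ i)
  + q%:R * \sum_(i < (minn N h).+1) (-1) ^+ (h + i) * #|codewords S f i|%:R *
     pless_coef N h i.
Proof.
move=> h_gt0; rewrite [LHS](power_sum_recursion _ N%:R); congr (_ + _).
have dual_weight0 : dual_weight chi S f 0 = 0%N.
  apply/eqP; rewrite cards_eq0; apply/eqP/setP => x.
  by rewrite !inE mul0r (add_char0 chiP) eqxx andbF.
under eq_bigr do rewrite -(two_dual_weight chiP char2).
transitivity ((-1) ^+ h * \sum_a (2 * (dual_weight chi S f a)%:R) ^+ h : rat).
  by rewrite [in RHS](bigD1 0) //= dual_weight0 mulr0 expr0n gtn_eqF // add0r.
rewrite pless_power_moment mulrCA mulr_sumr; congr (_ * _).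
by apply: eq_bigr => i _; rewrite exprD !mulrA.
Qed.

End BinaryPowerMoments.

(** * The canonical character *)

Lemma exists_nonroot (F : finFieldType) (p : {poly F}) :
  p != 0 -> (size p <= #|F|)%N -> exists x, ~~ root p x.
Proof.
move=> p0 p_small; apply/existsP; apply: contraT; rewrite negb_exists => /forallP rootp.
have := max_poly_roots p0 _ (enum_uniq F); rewrite -cardT => /(_ _)/leq_trans/(_ p_small).
by rewrite ltnn; apply; apply/allP => x _; apply/negbNE/rootp.
Qed.

Section AbsoluteTrace.
Variables (F : finFieldType) (r : nat).
Hypotheses (r_gt0 : (0 < r)%N) (cardF : #|F| = (2 ^ r)%N).

Lemma pchar2_card_pow2 : 2 \in [pchar F].
Proof. exact: card_finPcharP cardF _. Qed.

Lemma abstrD : {morph @abstr F r : x y / x + y}.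
Proof.
move=> x y; rewrite /abstr -big_split; apply: eq_bigr => k _.
by rewrite exprDn_pchar // pnatX pnatE ?pchar2_card_pow2.
Qed.

Lemma abstr_sqr (x : F) : abstr r (x ^+ 2) = abstr r x.
Proof.
rewrite /abstr; under eq_bigr do rewrite -exprM -expnS.
rewrite -(prednK r_gt0) big_ord_recr big_ord_recl /= prednK // -cardF expf_card expr1.
by rewrite addrC.
Qed.

Lemma abstr01 (x : F) : (abstr r x == 0) || (abstr r x == 1).
Proof.
have sqr_abstr : abstr r x ^+ 2 = abstr r x :> F.
  rewrite -[RHS]abstr_sqr -(pFrobenius_autE pchar2_card_pow2) rmorph_sum.
  by apply: eq_bigr => k _; rewrite /= pFrobenius_autE -!exprM mulnC.
by rewrite -[_ == 1]subr_eq0 -mulf_eq0 mulrBr mulr1 -expr2 sqr_abstr subrr.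
Qed.

Lemma abstr_neq0 : exists x : F, abstr r x != 0.
Proof.
pose p : {poly F} := \sum_(k < r) 'X^(2 ^ k).
have abstrE x : p.[x] = abstr r x.
  by rewrite horner_sum; apply: eq_bigr => k _; rewrite hornerXn.
have size_p : (size p <= #|F|)%N.
  rewrite cardF; apply: leq_trans (size_sum _ _ _) _; apply/bigmax_leqP => k _.
  by rewrite size_polyXn ltn_exp2l.
have p0 : p != 0.
  apply/eqP => /(congr1 (fun p : {poly F} => p`_1)); rewrite coef0 coef_sum.
  rewrite -(prednK r_gt0) big_ord_recl coefXn eqxx big1 ?addr0 => [/eqP|i _].
    by rewrite oner_eq0.
  by rewrite coefXn (_ : (1 == _)%N = false) // expnS; apply/negP; lia.
by have [x] := exists_nonroot p0 size_p; rewrite rootE abstrE; exists x.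
Qed.

Lemma lam_sqr (x : F) : lam r (x ^+ 2) = lam r x.
Proof. by rewrite /lam abstr_sqr. Qed.

Lemma nontrivial_add_char_lam : nontrivial_add_char (@lam F r).
Proof.
split=> [|x y|]; rewrite /lam.
- by rewrite /abstr big1 ?eqxx // => k _; rewrite expr0n expn_eq0.
- rewrite abstrD; case/orP: (abstr01 x) => /eqP->; case/orP: (abstr01 y) => /eqP->;
    by rewrite ?addr0 ?add0r ?(addrr_pchar2 pchar2_card_pow2) ?eqxx ?oner_eq0.
- by have [x /negPf x0] := abstr_neq0; exists x; rewrite x0.
Qed.

End AbsoluteTrace.

(** * The code of the special linear group *)

Section SpecialLinearCode.
Variables (F : finFieldType) (r s : nat).
Hypotheses (r_gt0 : (0 < r)%N) (s_gt0 : (0 < s)%N) (cardF : #|F| = (2 ^ r)%N).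
Local Notation n := (2 ^ s)%N.
Local Notation q := (2 ^ r)%N.
Local Notation lam_rat := (intr \o @lam F r : F -> rat).

Lemma card_SLset_pow2 :
  #|SLset F n| = (q ^ 'C(n, 2) * \prod_(2 <= j < n.+1) (q ^ j - 1))%N.
Proof. by rewrite card_SLset ?expn_gt0 // cardF. Qed.

Lemma nbeta_pow2 (b : F) :
  (nbeta n b)%:Z = (q ^ ('C(n, 2) - 1))%N%:Z *
    ((\prod_(2 <= j < n.+1) (q ^ j - 1))%N%:Z + 1 + q%:Z * theta r n b).
Proof.
have q0 : q%:Z != 0 by rewrite -lt0n expn_gt0.
have n_gt1 : (1 < n)%N by rewrite -[1%N]/(2 ^ 0)%N ltn_exp2l.
have odd_n1 : odd n.-1 by rewrite -subn1 oddB ?(ltnW n_gt1) // oddX eqn0Ngt s_gt0.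
have := card_SL_trace_pchar (nontrivial_add_char_lam r_gt0 cardF) (pchar2_card_pow2 cardF)
  (lam_sqr r_gt0 cardF) b s_gt0.
rewrite card_SLset_pow2 cardF !natz -signr_odd odd_n1 opprK => q_nbeta.
apply: (mulfI q0); rewrite q_nbeta [RHS]mulrA -[in RHS]PoszM -expnS.
rewrite subn1 prednK ?bin_gt0 //.
by rewrite PoszM -mulrDr [in RHS]addrAC addrA.
Qed.

Lemma nontrivial_add_char_lam_rat : nontrivial_add_char lam_rat.
Proof.
by apply/nontrivial_add_char_comp/nontrivial_add_char_lam => //; apply: intr_inj.
Qed.

Lemma sum_SL_lam_rat (a : F) : a != 0 ->
  \sum_(g in SLset F n) lam_rat (a * \tr g) =
  (q ^ 'C(n, 2))%:R * (Kloost r n.-1 a)%:~R.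
Proof.
move=> a0; have lam_rat_sqr x : lam_rat (x ^+ 2) = lam_rat x.
  by rewrite /= (lam_sqr r_gt0 cardF).
rewrite (sum_SL_char_pchar s nontrivial_add_char_lam_rat (pchar2_card_pow2 cardF)) //.
by rewrite kloosterman_comp cardF.
Qed.

Lemma MK_SL_moment i :
  \sum_(a : F | a != 0) (\sum_(g in SLset F n) lam_rat (a * \tr g)) ^+ i =
  (q ^ ('C(n, 2) * i))%N%:R * (MK F r n.-1 i)%:~R.
Proof.
rewrite /MK rmorph_sum mulr_sumr; apply: eq_bigr => a /sum_SL_lam_rat ->.
by rewrite exprMn -natrX -expnM -rmorphXn.
Qed.

End SpecialLinearCode.

Theorem theorem1 (F : finFieldType) (r s : nat) (hr : (0 < r)%N) (hs : (0 < s)%N)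
  (hF : #|F| = (2 ^ r)%N) :
  let n := (2 ^ s)%N in
  let q := (2 ^ r)%N in
  let P := (\prod_(2 <= j < n.+1) (q ^ j - 1))%N in
  let N := (q ^ 'C(n, 2) * P)%N in
  (forall h : nat, (0 < h)%N ->
     (q ^ ('C(n, 2) * h))%N%:R * (MK F r n.-1 h)%:~R
     = \sum_(i < h) (-1) ^+ (h + i + 1) * 'C(h, i)%:R * N%:R ^+ (h - i)
                      * (q ^ ('C(n, 2) * i))%N%:R * (MK F r n.-1 i)%:~R
       + q%:R * \sum_(i < (minn N h).+1)
                  (-1) ^+ (h + i) * (Cw F n i)%:R
                  * \sum_(i <= t < h.+1)
                      t`!%:R * stirling2 h t * 2 ^+ (h - t)
                      * (if (t <= N)%N then 'C(N - i, N - t) else 0%N)%:R :> rat)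
  /\ (forall b : F,
        (nbeta n b)%:Z
        = (q ^ ('C(n, 2) - 1))%N%:Z * (P%:Z + 1 + q%:Z * theta r n b))
  /\ (forall i : nat, (i <= N)%N ->
        Cw F n i
        = (\sum_(nu : {ffun F -> 'I_i.+1} |
                   ((\sum_(b : F) (nu b : nat))%N == i)
                   && ((\sum_(b : F) (b *+ nu b))%R == 0%R))
             \prod_(b : F) 'C(nbeta n b, nu b))%N).
Proof.
move=> n q P N; split; last split; last by move=> i _; apply: card_codewords_fiberwise.
  move=> h h_gt0.
  have := char_sum_moment_recursion (nontrivial_add_char_lam_rat hr hF)
    (pchar2_card_pow2 hF) (SLset F n) (fun g => \tr g) h_gt0.
  rewrite (MK_SL_moment s hr hF) (card_SLset_pow2 s hF) hF => ->; congr (_ + _).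
  by apply: eq_bigr => i _; rewrite (MK_SL_moment s hr hF) !mulrA.
exact: (nbeta_pow2 hr hs hF).
Qed.
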